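(* For every integral admissible state $s$, the selected move $s\mapsto s'$ satisfies $$m(s')\le\varphi^2\,m(s),\qquad \varphi^2=\frac{3+\sqrt5}{2}=2.618\ldots,$$ and the associated old-center energy estimate $T'_{\mathrm{old}}\le\varphi^2T$ is approached by Fibonacci-type profiles.
   Context: $K$ is a cubic number field of signature $(1,1)$, with real embedding $\sigma_r$ and complex embedding $\sigma_c$; $L\subset\mathcal O_K$ is an order; $\varphi=(1+\sqrt5)/2$. A state is an ordered triple $s=(u_1,u_2,u_3)$ of elements of $L$ (integral) forming a $\mathbb Q$-basis of $K$; it is admissible if $x_i=\sigma_r(u_i)>0$ for all $i$, and sorted so that $x_1\ge x_2\ge x_3>0$. Put $\xi=(x_1,x_2,x_3)$, $\nu=(\sigma_c(u_1),\sigma_c(u_2),\sigma_c(u_3))$, $\bar\zeta=\langle\xi,\nu\rangle/|\xi|^2$ (bilinear dot product; the bar is part of the symbol), $w_i=\sigma_c(u_i)-\bar\zeta x_i$ (deviations, so $\sum_i x_iw_i=0$), $T=\sum_i|w_i|^2$. With $a_\perp,b_\perp\in\mathbb R^3$ the real and imaginary parts of $(w_1,w_2,w_3)$, the conformal module is $m(s)=T/(2|a_\perp\times b_\perp|)$. Algorithm: for $A,B,g\in\mathbb Z_{\ge0}$ not all zero, the move $V(A,B,g)$ sends $(u_1,u_2,u_3)$ to $(u_1-g(u_2-Bu_3)-Au_3,\ u_2-Bu_3,\ u_3)$, and $W$ sends it to $(u_1-u_2,\ u_2,\ u_3-(u_1-u_2))$. Candidates at $s$ are the images of $s$ under those moves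 for which all new real coordinates are positive; the algorithm selects a candidate $s'$ of minimal $m$ (ties broken by a fixed order on move labels) and re-sorts it. The old-center energy is that of the head-difference candidate $V(0,0,1)$, i.e. $(u_1-u_2,u_2,u_3)$, with deviations computed with the center $\bar\zeta$ of $s$: $T'_{\mathrm{old}}=|w_1-w_2|^2+|w_2|^2+|w_3|^2$. Fibonacci-type profiles: as a quadratic-form inequality, $T'_{\mathrm{old}}\le\varphi^2T$ is an equality exactly on the ray $w_2=-\varphi w_1$, $w_3=0$, on which the constraint $\sum_i x_iw_i=0$ forces $x_1/x_2=\varphi$; integral states approach this head ratio through consecutive-Fibonacci head ratios, and ''approached by Fibonacci-type profiles'' means that the energy constant $\varphi^2$ is approached, not attained, in this way. *)

(* Defs.v *)
From HB Require Import structures.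
From mathcomp Require Import all_boot all_order all_algebra all_field.
From mathcomp Require Import complex.
From mathcomp Require Import boolp classical_sets reals topology normedtype.
From mathcomp Require Import sequences.

Set Implicit Arguments.
Unset Strict Implicit.
Unset Printing Implicit Defensive.

Import Order.TTheory GRing.Theory Num.Theory numFieldNormedType.Exports.
Import Normc.

Local Open Scope ring_scope.
Local Open Scope complex_scope.

(** * Number fields, signature, orders *)

Definition nonreal_embedding (R : realType) (K : fieldExtType rat)
  (tau : {rmorphism K -> R[i]}) : Prop := exists u, complex.Im (tau u) != 0.

(* [sr] is the only real embedding, and [sc], [conjc \o sc] are the only
   embeddings whose image is not contained in the reals. *)
Definition signature11 (R : realType) (K : fieldExtType rat)
    (sr : {rmorphism K -> R}) (sc : {rmorphism K -> R[i]}) : Prop :=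
  [/\ forall tau : {rmorphism K -> R}, tau =1 sr,
      nonreal_embedding sc &
      forall tau : {rmorphism K -> R[i]}, nonreal_embedding tau ->
        tau =1 sc \/ tau =1 (fun u => (sc u)^*)].

(* A subring of the ring of integers that is free over the integers on a
   Q-basis of [K]. *)
Definition is_order (K : fieldExtType rat) (L : {pred K}) : Prop :=
  [/\ GRing.subring_closed L,
      forall u, u \in L -> integralOver (intr : int -> K) u &
      exists2 e : (\dim {:K}).-tuple K, basis_of fullv e &
        forall u, u \in L <->
          exists c : 'I_(\dim {:K}) -> int, u = \sum_i tnth e i *~ c i].

(** * States; indices 0, 1, 2 : 'I_3 stand for 1, 2, 3 *)

Definition golden (R : realType) : R := (1 + Num.sqrt 5) / 2.

(* squared Hermitian length *)
Definition energy (R : realType) (w : 'rV[R[i]]_3) : R :=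
  \sum_i normc (w 0 i) ^+ 2.

Definition norm3 (R : realType) (a : 'rV[R]_3) : R :=
  Num.sqrt (\sum_i a 0 i ^+ 2).

(* The indices are computed modulo 3. *)
Definition cross3 (R : realType) (a b : 'rV[R]_3) : 'rV[R]_3 :=
  \row_(i < 3) (a 0 (i + 1) * b 0 (i + 2) - a 0 (i + 2) * b 0 (i + 1)).

Definition head_form (R : realType) (w : 'rV[R[i]]_3) : R :=
  normc (w 0 0 - w 0 1) ^+ 2 + normc (w 0 1) ^+ 2 + normc (w 0 2) ^+ 2.

Section States.

Variables (R : realType) (K : fieldExtType rat).
Variables (sr : {rmorphism K -> R}) (sc : {rmorphism K -> R[i]}).
Implicit Types (s : 3.-tuple K).

Definition xi s : 'rV[R]_3 := \row_i sr (tnth s i).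
Definition nu s : 'rV[R[i]]_3 := \row_i sc (tnth s i).

Definition head_ratio s : R := xi s 0 0 / xi s 0 1.

Definition center s : R[i] :=
  (\sum_i (xi s 0 i)%:C * nu s 0 i) / (\sum_i xi s 0 i ^+ 2)%:C.

(* deviations of [s] from an arbitrary center [z] *)
Definition deviation (z : R[i]) s : 'rV[R[i]]_3 :=
  \row_i (nu s 0 i - z * (xi s 0 i)%:C).

Definition dev s : 'rV[R[i]]_3 := deviation (center s) s.

Definition T s : R := energy (dev s).

Definition conformal_module s : R :=
  T s / (2 * norm3 (cross3 (map_mx (@complex.Re R) (dev s))
                           (map_mx (@complex.Im R) (dev s)))).

Definition positive_state s : bool := all (fun u => 0 < sr u) s.

Definition decreasing (u v : K) : bool := sr v <= sr u.

Definition integral_admissible (L : {pred K}) s : Prop :=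
  [/\ all [in L] s, basis_of fullv s, positive_state s & sorted decreasing s].

(** * Moves *)

Inductive move := V of nat & nat & nat | W.

Definition valid_move (mv : move) : bool :=
  if mv is V A B g then [|| A != 0%N, B != 0%N | g != 0%N] else true.

Definition apply_move (mv : move) s : 3.-tuple K :=
  let u1 := tnth s 0 in let u2 := tnth s 1 in let u3 := tnth s 2 in
  match mv with
  | V A B g => [tuple u1 - (u2 - u3 *+ B) *+ g - u3 *+ A; u2 - u3 *+ B; u3]
  | W => [tuple u1 - u2; u2; u3 - (u1 - u2)]
  end.

Definition candidate s (mv : move) : bool :=
  valid_move mv && positive_state (apply_move mv s).

(* [le] is the order on move labels that breaks ties. *)
Definition total_order (le : rel move) : Prop :=
  [/\ antisymmetric le, transitive le & total le].

Definition selected (le : rel move) s (mv : move) : Prop :=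
  candidate s mv /\
  forall mv', candidate s mv' ->
    conformal_module (apply_move mv s) <= conformal_module (apply_move mv' s)
    /\ (conformal_module (apply_move mv s)
          = conformal_module (apply_move mv' s) -> le mv mv').

Definition next_state (mv : move) s : 3.-tuple K :=
  [tuple of sort decreasing (apply_move mv s)].

(** * Old-center energy *)

Definition T_old s : R := energy (deviation (center s) (apply_move (V 0 0 1) s)).

Lemma T_oldE s : T_old s = head_form (dev s).
Proof.
rewrite /T_old /head_form /energy !big_ord_recl big_ord0 addr0 addrA !mxE.
have l0 : lift ord0 ord0 = 1 :> 'I_3 by apply/val_inj.
have l1 : lift ord0 (lift ord0 ord0) = 2 :> 'I_3 by apply/val_inj.
rewrite !l0 !l1 /= !(tnth_nth 0) /= !mulr0n subr0 subr0 mulr1n !rmorphB.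
congr (normc _ ^+ 2 + _ + _).
by rewrite mulrBr !opprB addrACA [RHS]addrACA (addrC (- sc _)); congr (_ + _).
Qed.

(** * Fibonacci-type profiles *)

Fixpoint fib (n : nat) : nat :=
  if n is n1.+1 then (if n1 is n2.+1 then (fib n1 + fib n2)%N else 1%N)
  else 0%N.

(* The head ratio of the n-th state is the ratio of the consecutive Fibonacci
   numbers F_(n+2) / F_(n+1) up to the tolerance [eps n] (for integral states
   it cannot be equal to it, the entries being independent over Q), it tends
   to [golden], and the deviations tend projectively to the ray
   w_2 = - golden * w_1, w_3 = 0. *)
Definition fibonacci_type (eps : nat -> R) (s : nat -> 3.-tuple K) : Prop :=
  [/\ forall n, `|head_ratio (s n) - (fib n.+2)%:R / (fib n.+1)%:R| < eps n,
      ((fun n => head_ratio (s n)) @ \oo --> golden R)%classic,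
      ((fun n => normc (dev (s n) 0 1 / dev (s n) 0 0 + (golden R)%:C))
         @ \oo --> (0 : R))%classic &
      ((fun n => normc (dev (s n) 0 2 / dev (s n) 0 0))
         @ \oo --> (0 : R))%classic].

End States.

(* Main.v *)
Require Import Defs.
From mathcomp Require Import all_boot all_order all_algebra all_field.
From mathcomp Require Import complex.
From mathcomp Require Import boolp classical_sets reals topology normedtype.
From mathcomp Require Import sequences.
From mathcomp Require Import ring lra.

(** The bound on the selected move comes from comparing it with a single
    candidate, the head difference [V 0 0 1], which replaces [u_1] by
    [u_1 - u_2].  It is always a candidate, since the real embedding is
    injective and hence [x_1 > x_2], so the minimal conformal module is at most
    the one of this candidate.

    For the candidate, the conformal module is rewritten as
    [T * |xi| / (2 * |vol|)], where [vol] is the triple product of [xi] with the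
    real and the imaginary part of [nu]: both parts of the deviations are
    orthogonal to [xi], so their cross product is a multiple of [xi]
    ([conformal_moduleE]).  The head difference is unimodular and preserves
    [vol]; it decreases the first positive coordinate, hence [|xi|]; and [T] is
    the minimum over all centers of the energy of the deviations ([T_min]), so
    its new value is at most the energy [T_old] computed with the old center.
    What remains is [T_old <= phi^2 T], which is a statement on quadratic
    forms: with [phi^2 = phi + 1], the difference [phi^2 T - T_old] equals
    [(phi - 1) |w_2 + phi w_1|^2 + phi |w_3|^2] ([head_deficitE]).  Existence
    and uniqueness of the selected move hold because positivity leaves finitely
    many candidates ([candidate_bounded]).

    Equality in the energy estimate forces [x_1 / x_2 = phi] by orthogonality.
    Then [u_1 / u_2] is a root of [X^2 - X - 1] in a cubic field, which is
    impossible: an element of a cubic field is rational or has degree 3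
    ([cubic_relation_trivial]), and [u_1], [u_2] are independent over the
    rationals.

    To approach the constant, take [theta] in [L] with [theta] not real in the
    complex embedding and positive in the real one, and the states
    [(F_(n+2) M + k theta, F_(n+1) M, theta^2)].  Multiples of [xi] do not
    contribute to the deviations, so only [k theta] and [theta^2] do.  As
    [k -> oo] the former dominates, whence [w_3 / w_1 -> 0]; and when [M] is
    large with respect to [k], the head ratio is as close as desired to
    [F_(n+2) / F_(n+1)].  The orthogonality relation then gives
    [w_2 / w_1 -> - phi], and by the formula for [phi^2 T - T_old] the energy
    ratio tends to [phi^2] ([fibonacci_limits]). *)

Set Implicit Arguments.
Unset Strict Implicit.
Unset Printing Implicit Defensive.

Import Order.TTheory GRing.Theory Num.Theory numFieldNormedType.Exports.
Import Normc.

Local Open Scope ring_scope.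
Local Open Scope complex_scope.

Lemma sum3E (V : nmodType) (F : 'I_3 -> V) : \sum_i F i = F 0 + F 1 + F 2.
Proof.
rewrite !big_ord_recl big_ord0 addr0 addrA.
by congr (_ + F _ + F _); apply/val_inj.
Qed.

Lemma forall_ord3 (P : 'I_3 -> Prop) : P 0 -> P 1 -> P 2 -> forall i, P i.
Proof.
move=> P0 P1 P2 [[|[|[|//]]] i]; [move: P0|move: P1|move: P2];
by congr (P _); apply/val_inj.
Qed.

(** * The golden ratio and Fibonacci quotients *)

Section Golden.

Variable R : realType.
Local Notation phi := (golden R).

Lemma golden_sqrE : phi ^+ 2 = (3 + Num.sqrt 5) / 2.
Proof. by rewrite /golden; have := sqr_sqrtr (ler0n R 5); lra. Qed.

Lemma golden_sqr : phi ^+ 2 = phi + 1.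
Proof. by rewrite golden_sqrE /golden; lra. Qed.

Lemma golden_bounds : 1 < phi < 2.
Proof.
rewrite /golden; have := sqr_sqrtr (ler0n R 5); have := sqrtr_ge0 (5 : R).
move: (Num.sqrt 5) => t; nra.
Qed.

Lemma golden_gt0 : 0 < phi.
Proof. by have := golden_bounds; lra. Qed.

(** [1 - phi] is the conjugate of [phi], and [F_(n+1) - phi F_n] satisfies the
    Fibonacci recurrence with the initial values of its powers. *)
Lemma fib_golden n :
  (fib n.+2)%:R - phi * (fib n.+1)%:R = (1 - phi) ^+ n.+1 :> R.
Proof.
have phi2 := golden_sqr.
have [] : (fib n.+2)%:R - phi * (fib n.+1)%:R = (1 - phi) ^+ n.+1 :> R /\
          (fib n.+3)%:R - phi * (fib n.+2)%:R = (1 - phi) ^+ n.+2 :> R;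
  last by [].
elim: n => [|n [IH1 IH2]]; first by rewrite /=; split; rewrite ?expr1; nra.
split=> //; have fibD m : (fib m.+2)%:R = (fib m.+1)%:R + (fib m)%:R :> R.
  by rewrite -natrD.
have -> : (1 - phi) ^+ n.+3 = (1 - phi) ^+ n.+2 + (1 - phi) ^+ n.+1.
  by rewrite !(exprS _ _.+1) (exprS _ n); ring: phi2.
by rewrite -IH1 -IH2 (fibD n.+2) (fibD n.+1); ring.
Qed.

Lemma fib_gt0 n : (0 < fib n.+1)%N.
Proof.
have [] : (0 < fib n.+1)%N /\ (0 < fib n.+2)%N; last by [].
by elim: n => [|n [IH1 IH2]] //; split=> //; rewrite addn_gt0 IH2.
Qed.

Lemma fibSS n : fib n.+2 = (fib n.+1 + fib n)%N.
Proof. by []. Qed.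

Lemma fib_mono n : (fib n <= fib n.+1)%N.
Proof. by case: n => // n; rewrite fibSS leq_addr. Qed.

Lemma fib_le n : (fib n.+2 <= 2 * fib n.+1)%N.
Proof. by rewrite fibSS mul2n -addnn leq_add2l fib_mono. Qed.

Lemma fib_ratio_golden n :
  `|(fib n.+2)%:R / (fib n.+1)%:R - phi| <= (phi - 1) ^+ n :> R.
Proof.
have /andP[phi1 phi2] := golden_bounds.
have Fge1 : 1 <= (fib n.+1)%:R :> R by rewrite ler1n fib_gt0.
have F0 : (fib n.+1)%:R != 0 :> R by rewrite lt0r_neq0 // (lt_le_trans ltr01).
have -> : (fib n.+2)%:R / (fib n.+1)%:R - phi
          = (1 - phi) ^+ n.+1 / (fib n.+1)%:R :> R.
  by rewrite -fib_golden; field.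
rewrite normf_div normrX (distrC 1) (gtr0_norm (x := phi - 1)) ?subr_gt0 //.
rewrite ger0_norm // ler_pdivrMr; last exact: lt_le_trans Fge1.
rewrite exprS mulrC ler_wpM2l ?exprn_ge0 ?subr_ge0 ?(ltW phi1) //.
by apply: le_trans Fge1; lra.
Qed.

End Golden.

(** * The energy of the head difference as a quadratic form *)

Section Energy.

Variable R : realType.
Local Notation phi := (golden R).
Implicit Types (w : 'rV[R[i]]_3) (z : R[i]).

Lemma sqr_normcE z : normc z ^+ 2 = complex.Re z ^+ 2 + complex.Im z ^+ 2.
Proof. by case: z => a b /=; rewrite sqr_sqrtr // addr_ge0 ?sqr_ge0. Qed.

Lemma normc_ge0 z : 0 <= normc z.
Proof. by case: z => a b; apply: sqrtr_ge0. Qed.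

Lemma normc_real (a : R) : normc a%:C = `|a|.
Proof. by rewrite /= expr0n addr0 sqrtr_sqr. Qed.

Lemma normc_eq0 z : (normc z == 0) = (z == 0).
Proof. by apply/eqP/eqP => [/eq0_normc|->]; rewrite ?normc0. Qed.

Lemma energyE w :
  energy w = normc (w 0 0) ^+ 2 + normc (w 0 1) ^+ 2 + normc (w 0 2) ^+ 2.
Proof. exact: sum3E. Qed.

(** The hermitian form [phi^2 E - H] has rank 2: in the first two coordinates
    its determinant vanishes because [phi^2 = phi + 1], so it is a multiple of
    one square.  Both the inequality with its equality case and the rate at
    which the ratio tends to [phi^2] are read off from it. *)
Lemma head_deficitE w :
  phi ^+ 2 * energy w - head_form w =
  (phi - 1) * normc (w 0 1 + phi%:C * w 0 0) ^+ 2 + phi * normc (w 0 2) ^+ 2.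
Proof.
rewrite energyE /head_form !sqr_normcE; have := golden_sqr R.
case: (w 0 0) => a b; case: (w 0 1) => c d; case: (w 0 2) => e f /=.
move: (golden R) => p hp; rewrite !mul0r subr0 addr0.
have p3 : p ^+ 3 = 2 * p + 1 by rewrite exprS hp mulrDr -expr2 hp; ring.
ring: hp p3.
Qed.

Lemma head_form_leif w :
  head_form w <= phi ^+ 2 * energy w
    ?= iff ((w 0 1 == - phi%:C * w 0 0) && (w 0 2 == 0)).
Proof.
have /andP[phi1 _] := golden_bounds R; have phi0 := golden_gt0 R.
have := head_deficitE w; set d := normc _; set e := normc _ => def.
have ge1 : 0 <= (phi - 1) * d ^+ 2 by rewrite mulr_ge0 ?sqr_ge0 // subr_ge0 ltW.
have ge2 : 0 <= phi * e ^+ 2 by rewrite mulr_ge0 ?sqr_ge0 // ltW.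
split; first by rewrite -subr_ge0 def addr_ge0.
rewrite eq_sym -subr_eq0 def paddr_eq0 // (mulf_eq0 (phi - 1)) (mulf_eq0 phi).
rewrite !sqrf_eq0 !normc_eq0 subr_eq0 (gt_eqF phi1) (gt_eqF phi0).
by rewrite mulNr -addr_eq0.
Qed.

Lemma ray_head_ratio (x : 'rV[R]_3) w :
  (forall i, 0 < x 0 i) -> w != 0 ->
  \sum_i (x 0 i)%:C * w 0 i = 0 ->
  w 0 1 = - phi%:C * w 0 0 -> w 0 2 = 0 ->
  x 0 0 / x 0 1 = phi.
Proof.
move=> x0 wN0; rewrite sum3E => + w1 w2; rewrite w1 w2 mulr0 addr0.
have [w00|w00] := eqVneq (w 0 0) 0.
  case/eqP: wN0; apply/rowP => j; rewrite mxE.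
  by elim/forall_ord3: j; rewrite ?w2 ?w1 ?w00 ?mulr0.
rewrite mulrA -mulrDl => /eqP; rewrite mulf_eq0 (negPf w00) orbF.
rewrite mulrN -rmorphM -rmorphB => /eqP[] /eqP; rewrite subr_eq0 => /eqP->.
by rewrite mulrAC divff ?mul1r // gt_eqF.
Qed.

End Energy.

(** * Cross products *)

Section CrossProduct.

Variable R : realType.
Implicit Types (a b x : 'rV[R]_3).

Lemma cross3E a b :
  [/\ cross3 a b 0 0 = a 0 1 * b 0 2 - a 0 2 * b 0 1,
      cross3 a b 0 1 = a 0 2 * b 0 0 - a 0 0 * b 0 2 &
      cross3 a b 0 2 = a 0 0 * b 0 1 - a 0 1 * b 0 0].
Proof.
by split; rewrite mxE; congr (a _ _ * b _ _ - a _ _ * b _ _); apply/val_inj.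
Qed.

Definition triple_product x a b : R := \sum_i x 0 i * cross3 a b 0 i.

Lemma triple_productE x a b : triple_product x a b =
  x 0 0 * (a 0 1 * b 0 2 - a 0 2 * b 0 1)
  + x 0 1 * (a 0 2 * b 0 0 - a 0 0 * b 0 2)
  + x 0 2 * (a 0 0 * b 0 1 - a 0 1 * b 0 0).
Proof. by rewrite /triple_product sum3E; case: (cross3E a b) => -> -> ->. Qed.

(** By Lagrange, [|c|^2 |x|^2 = (x . c)^2 + |x ^ c|^2] for [c] the cross product
    of [a] and [b], and [x ^ c = a (x . b) - b (x . a)] vanishes here. *)
Lemma norm3_cross_orthogonal x a b :
  \sum_i x 0 i * a 0 i = 0 -> \sum_i x 0 i * b 0 i = 0 ->
  norm3 (cross3 a b) * norm3 x = `|triple_product x a b|.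
Proof.
rewrite /norm3 -sqrtrM ?sumr_ge0// => [xa xb|? _]; last exact: sqr_ge0.
rewrite -sqrtr_sqr; congr Num.sqrt; move: xa xb.
rewrite triple_productE !sum3E; case: (cross3E a b) => -> -> -> xa xb.
set p := (X in X = 0) in xa; set q := (X in X = 0) in xb.
transitivity (triple_product x a b ^+ 2 + ((a 0 0 * q - b 0 0 * p) ^+ 2
    + (a 0 1 * q - b 0 1 * p) ^+ 2 + (a 0 2 * q - b 0 2 * p) ^+ 2)).
  by rewrite triple_productE /p /q; ring.
by rewrite xa xb triple_productE; ring.
Qed.

(** In this form the norm depends on symmetric sums only, hence is unchanged by
    a permutation of the coordinates. *)
Lemma norm3_cross_gram a b :
  norm3 (cross3 a b) = Num.sqrt ((\sum_i a 0 i ^+ 2) * (\sum_i b 0 i ^+ 2)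
                                 - (\sum_i a 0 i * b 0 i) ^+ 2).
Proof.
congr Num.sqrt; rewrite !sum3E; case: (cross3E a b) => -> -> ->; ring.
Qed.

End CrossProduct.

(** * Deviations and the conformal module *)

Section Centers.

Variables (R : realType) (K : fieldExtType rat).
Variables (sr : {rmorphism K -> R}) (sc : {rmorphism K -> R[i]}).
Implicit Types (s : 3.-tuple K) (z : R[i]).

Local Notation xi := (xi sr).
Local Notation nu := (nu sc).
Local Notation center := (Defs.center sr sc).
Local Notation deviation := (deviation sr sc).
Local Notation dev := (dev sr sc).
Local Notation T := (T sr sc).
Local Notation Re := (@complex.Re R).
Local Notation Im := (@complex.Im R).

Lemma Re_sum (I : finType) (F : I -> R[i]) : Re (\sum_i F i) = \sum_i Re (F i).
Proof. by apply: (big_morph Re) => // -[? ?] [? ?]. Qed.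

Lemma Im_sum (I : finType) (F : I -> R[i]) : Im (\sum_i F i) = \sum_i Im (F i).
Proof. by apply: (big_morph Im) => // -[? ?] [? ?]. Qed.

Lemma center_ReE s :
  Re (center s) = (\sum_i xi s 0 i * Re (nu s 0 i)) / \sum_i xi s 0 i ^+ 2.
Proof.
rewrite /Defs.center -fmorphV mulrC -[RHS]mulrC.
have ReM (r : R) (z : R[i]) : Re (r%:C * z) = r * Re z.
  by case: z => a b /=; rewrite mul0r subr0.
by rewrite ReM Re_sum; congr (_ * _); apply: eq_bigr => i _; rewrite ReM.
Qed.

Lemma center_ImE s :
  Im (center s) = (\sum_i xi s 0 i * Im (nu s 0 i)) / \sum_i xi s 0 i ^+ 2.
Proof.
rewrite /Defs.center -fmorphV mulrC -[RHS]mulrC.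
have ImM (r : R) (z : R[i]) : Im (r%:C * z) = r * Im z.
  by case: z => a b /=; rewrite mul0r addr0.
by rewrite ImM Im_sum; congr (_ * _); apply: eq_bigr => i _; rewrite ImM.
Qed.

Lemma Re_deviation z s i :
  Re (deviation z s 0 i) = Re (nu s 0 i) - Re z * xi s 0 i.
Proof.
rewrite mxE; case: (nu _ _ _) => a b; case: z => c d /=.
by rewrite mulr0 subr0.
Qed.

Lemma Im_deviation z s i :
  Im (deviation z s 0 i) = Im (nu s 0 i) - Im z * xi s 0 i.
Proof.
rewrite mxE; case: (nu _ _ _) => a b; case: z => c d /=.
by rewrite mulr0 add0r.
Qed.

Lemma positive_stateP s :
  reflect (forall i, 0 < xi s 0 i) (positive_state sr s).
Proof.
apply: (iffP all_tnthP) => pos i; last by have := pos i; rewrite mxE.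
by rewrite mxE.
Qed.

Lemma sum_xi_gt0 s : positive_state sr s -> 0 < \sum_i xi s 0 i ^+ 2.
Proof.
by move=> /positive_stateP pos; rewrite sum3E !addr_gt0 ?exprn_gt0.
Qed.

Lemma dev_Re_orthogonal s : positive_state sr s ->
  \sum_i xi s 0 i * Re (dev s 0 i) = 0.
Proof.
move=> /sum_xi_gt0/lt0r_neq0; rewrite !sum3E !Re_deviation center_ReE !sum3E.
by move=> N0; field.
Qed.

Lemma dev_Im_orthogonal s : positive_state sr s ->
  \sum_i xi s 0 i * Im (dev s 0 i) = 0.
Proof.
move=> /sum_xi_gt0/lt0r_neq0; rewrite !sum3E !Im_deviation center_ImE !sum3E.
by move=> N0; field.
Qed.

Lemma dev_orthogonal s : positive_state sr s ->
  \sum_i (xi s 0 i)%:C * dev s 0 i = 0.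
Proof.
move=> pos; have := dev_Re_orthogonal pos; have := dev_Im_orthogonal pos.
rewrite !sum3E; case: (dev s 0 0) (dev s 0 1) (dev s 0 2) => [a b] [c d] [e f].
move=> /= him hre; apply/eqP; rewrite eq_complex /= !mul0r !subr0 !addr0.
by rewrite hre him !eqxx.
Qed.

(** Least squares: moving the center away from the orthogonal projection by
    [d] adds [|d|^2 |xi|^2] to the energy. *)
Lemma T_min z s : positive_state sr s -> T s <= energy (deviation z s).
Proof.
move=> pos; have hre := dev_Re_orthogonal pos.
have him := dev_Im_orthogonal pos.
set c := center s.
suff -> : energy (deviation z s)
          = T s + ((Re c - Re z) ^+ 2 + (Im c - Im z) ^+ 2)
                  * \sum_i xi s 0 i ^+ 2.
  by rewrite lerDl mulr_ge0 ?addr_ge0 ?sqr_ge0 // ltW // sum_xi_gt0.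
move: hre him; rewrite /T !energyE !sqr_normcE !sum3E.
rewrite !Re_deviation !Im_deviation -/c => hre him.
apply/eqP; rewrite -subr_eq0; apply/eqP.
transitivity (2 * (Re c - Re z) * 0 + 2 * (Im c - Im z) * 0 : R); last by ring.
by rewrite -{1}hre -him; ring.
Qed.

Lemma T_ge0 s : 0 <= T s.
Proof. by apply: sumr_ge0 => i _; apply: sqr_ge0. Qed.

(** Up to sign and the choice of coordinates, the covolume of the lattice
    spanned by the state in the product of its real and complex embedding. *)
Definition covolume s : R :=
  triple_product (xi s) (map_mx Re (nu s)) (map_mx Im (nu s)).

(** Replacing [nu] by the deviations subtracts multiples of [xi] from its real
    and imaginary parts, which does not change the triple product with [xi].
    When the covolume is 0, both sides are quotients by 0. *)
Lemma conformal_moduleE s : positive_state sr s ->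
  conformal_module sr sc s = T s * norm3 (xi s) / (2 * `|covolume s|).
Proof.
move=> pos; have N0 := sum_xi_gt0 pos.
have n0 : norm3 (xi s) != 0 by rewrite gt_eqF // sqrtr_gt0.
have -> : `|covolume s| = norm3 (cross3 (map_mx Re (dev s)) (map_mx Im (dev s)))
                         * norm3 (xi s).
  rewrite norm3_cross_orthogonal.
  - congr `|_|; rewrite /covolume !triple_productE ![map_mx _ _ _ _]mxE.
    by rewrite !Re_deviation !Im_deviation !mxE; ring.
  - rewrite -[RHS](dev_Re_orthogonal pos); apply: eq_bigr => i _.
    by rewrite [map_mx _ _ _ _]mxE.
  - rewrite -[RHS](dev_Im_orthogonal pos); apply: eq_bigr => i _.
    by rewrite [map_mx _ _ _ _]mxE.
rewrite /conformal_module mulrA -mulf_div divff ?mulr1 //.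
Qed.

Lemma apply_head_difference s :
  apply_move (V 0 0 1) s = [tuple tnth s 0 - tnth s 1; tnth s 1; tnth s 2].
Proof. by rewrite /apply_move !mulr0n !subr0 mulr1n. Qed.

Lemma tuple3E (t : 3.-tuple K) :
  (tnth t 0 = t`_0) * (tnth t 1 = t`_1) * (tnth t 2 = t`_2).
Proof. by rewrite !(tnth_nth 0). Qed.

Lemma covolume_head_difference s :
  covolume (apply_move (V 0 0 1) s) = covolume s.
Proof.
rewrite apply_head_difference /covolume !triple_productE !mxE.
rewrite !(tuple3E [tuple _; _; _]) /= !rmorphB.
case: (sc _) (sc _) (sc _) => [a b] [c d] [e f] /=; ring.
Qed.

Lemma norm3_head_difference s :
  positive_state sr s -> positive_state sr (apply_move (V 0 0 1) s) ->
  norm3 (xi (apply_move (V 0 0 1) s)) <= norm3 (xi s).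
Proof.
move=> /positive_stateP pos /positive_stateP; rewrite apply_head_difference.
move=> /(_ 0); rewrite !mxE !(tuple3E [tuple _; _; _]) /= rmorphB => d0.
rewrite /norm3; apply: ler_wsqrtr; rewrite !sum3E !mxE.
rewrite !(tuple3E [tuple _; _; _]) /= rmorphB.
have := pos 0; have := pos 1; rewrite !mxE.
move: d0; move: (sr _) (sr _) (sr _) => x y z; nra.
Qed.

Lemma conformal_module_head_difference s :
  positive_state sr s -> positive_state sr (apply_move (V 0 0 1) s) ->
  conformal_module sr sc (apply_move (V 0 0 1) s)
    <= golden R ^+ 2 * conformal_module sr sc s.
Proof.
move=> pos pos'; rewrite !conformal_moduleE // covolume_head_difference.
rewrite mulrA ler_wpM2r ?invr_ge0 ?mulr_ge0 // mulrA.
rewrite ler_pM ?T_ge0 ?sqrtr_ge0 //.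
  apply: le_trans (T_min (center s) pos') _.
  by rewrite -/(T_old sr sc s) T_oldE; case: (head_form_leif (dev s)).
exact: norm3_head_difference.
Qed.

Lemma conformal_module_perm s (t : 3.-tuple K) :
  perm_eq s t -> conformal_module sr sc s = conformal_module sr sc t.
Proof.
move=> st.
have sumP (V : nmodType) (f : K -> V) (F G : 'I_3 -> V) :
    (forall i, F i = f (tnth s i)) -> (forall i, G i = f (tnth t i)) ->
  \sum_i F i = \sum_i G i.
  move=> FE GE; rewrite (eq_bigr _ (fun i _ => FE i)).
  rewrite (eq_bigr _ (fun i _ => GE i)).
  by rewrite -!(big_tuple _ _ _ xpredT f) (perm_big _ st).
have centerP : center s = center t.
  rewrite /Defs.center; congr (_ / _%:C).
    by apply: (sumP _ (fun u => (sr u)%:C * sc u)) => i; rewrite !mxE.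
  by apply: (sumP _ (fun u => sr u ^+ 2)) => i; rewrite !mxE.
have devP (f : R[i] -> R) (F G : 'I_3 -> R) :
    (forall i, F i = f (dev s 0 i)) -> (forall i, G i = f (dev t 0 i)) ->
  \sum_i F i = \sum_i G i.
  move=> FE GE; apply: (sumP _ (fun u => f (sc u - center s * (sr u)%:C))) => i.
    by rewrite FE !mxE.
  by rewrite GE centerP !mxE.
rewrite /conformal_module /T /energy !norm3_cross_gram.
congr (_ / (2 * Num.sqrt (_ * _ - _ ^+ 2))).
- exact: (devP (fun z => normc z ^+ 2)).
- by apply: (devP (fun z => Re z ^+ 2)) => i; rewrite [map_mx _ _ _ _]mxE.
- by apply: (devP (fun z => Im z ^+ 2)) => i; rewrite [map_mx _ _ _ _]mxE.
- by apply: (devP (fun z => Re z * Im z)) => i; rewrite ![map_mx _ _ _ _]mxE.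
Qed.

End Centers.

(** * The selected move *)

Section Selection.

Variables (R : realType) (K : fieldExtType rat).
Variables (sr : {rmorphism K -> R}) (sc : {rmorphism K -> R[i]}).
Implicit Types (s : 3.-tuple K).

(** Positivity of the second coordinate bounds [B]; positivity of the first one
    bounds [A], and bounds [g] in terms of [u_2 - B u_3], which takes finitely
    many values. *)
Lemma candidate_bounded s : positive_state sr s ->
  exists N, forall A B g, candidate sr s (V A B g) ->
    [/\ A < N, B < N & g < N]%N.
Proof.
move=> /positive_stateP pos.
set x := sr (tnth s 0); set y := sr (tnth s 1); set z := sr (tnth s 2).
have x0 : 0 < x by have := pos 0; rewrite mxE.
have z0 : 0 < z by have := pos 2; rewrite mxE.
have ltn_trunc n (a b : R) : 0 < b -> n%:R * b < a ->
    (n <= Num.trunc (a / b))%N.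
  move=> b0 nb; have ab : n%:R <= a / b by rewrite ler_pdivlMr // ltW.
  by rewrite -ltnS -(ltr_nat R) (le_lt_trans ab) // truncnS_gt.
pose NA := Num.trunc (x / z); pose NB := Num.trunc (y / z).
pose Ng := \max_(b < NB.+1) Num.trunc (x / (y - b%:R * z)).
exists (NA + NB + Ng).+1 => A B g /andP[_] /positive_stateP pos'.
have := pos' 0; have := pos' 1; rewrite !mxE !(tuple3E [tuple _; _; _]) /=.
rewrite !rmorphB !rmorphMn rmorphB rmorphMn -/x -/y -/z.
rewrite -!(mulr_natl z) -(mulr_natl (y - _)) => yB xA.
have A0 := ler0n R A; have g0 := ler0n R g.
have leA : (A <= NA)%N by apply: ltn_trunc => //; nra.
have leB : (B <= NB)%N by apply: ltn_trunc => //; lra.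
have leg : (g <= Ng)%N.
  have leBg : (g <= Num.trunc (x / (y - B%:R * z)))%N.
    by apply: ltn_trunc => //; nra.
  apply: leq_trans leBg _; rewrite -ltnS in leB.
  exact: (leq_bigmax (F := fun b : 'I_NB.+1 => Num.trunc (x / (y - b%:R * z)))
                     (Ordinal leB)).
split; rewrite ltnS; first by rewrite (leq_trans leA) // -addnA leq_addr.
  by rewrite (leq_trans leB) // addnAC leq_addl.
by rewrite (leq_trans leg) // leq_addl.
Qed.

(** The selected move is the minimum of the finitely many candidates for the
    total order that compares first the conformal module and then the label. *)
Lemma selected_exists_unique (le : rel move) s mv0 :
  total_order le -> positive_state sr s -> candidate sr s mv0 ->
  exists! mv, selected sr sc le s mv.
Proof.
move=> [le_anti le_trans le_total] pos cand0.
have [N boundN] := candidate_bounded pos.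
pose f (i : option ('I_N * 'I_N * 'I_N)) :=
  if i is Some (a, b, g) then V a b g else W.
have fP mv : candidate sr s mv -> exists i, mv = f i.
  case: mv => [A B g /boundN[ltA ltB ltg]|_]; last by exists None.
  by exists (Some (Ordinal ltA, Ordinal ltB, Ordinal ltg)).
pose m mv := conformal_module sr sc (apply_move mv s).
pose ord i j := (m (f i) < m (f j)) || (m (f i) == m (f j)) && le (f i) (f j).
have ord_total : total ord.
  by move=> i j; rewrite /ord; case: ltgtP => //= _; apply: le_total.
have ord_refl : reflexive ord by move=> i; have := ord_total i i; rewrite orbb.
have ord_trans : transitive ord.
  move=> j i k; rewrite /ord.
  move=> /orP[ij|/andP[/eqP-> ij]] /orP[jk|/andP[/eqP<- jk]].
  - by rewrite (lt_trans ij).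
  - by rewrite ij.
  - by rewrite jk.
  - by rewrite eqxx (le_trans _ _ _ ij) ?orbT.
have [i0 def0] := fP _ cand0; rewrite def0 in cand0.
case: (extremumP (P := fun i => candidate sr s (f i)) id
         ord_refl ord_trans ord_total cand0) => i candi mini.
have sel : selected sr sc le s (f i).
  split=> // mv' /[dup] cand' /fP[j def']; rewrite def' in cand' *.
  have /orP[ij|/andP[/eqP ij leij]] := mini j cand'; last by rewrite -/(m _) ij.
  by split; [exact: ltW | move=> eij; rewrite /m eij ltxx in ij].
exists (f i); split=> // mv' [cand' min'].
have [ge1 le1] := min' _ candi; have [ge2 le2] := sel.2 _ cand'.
have e : m (f i) = m mv' by apply/eqP; rewrite eq_le ge1 ge2.
by apply: le_anti; rewrite (le1 (esym e)) (le2 e).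
Qed.

Lemma head_difference_candidate (L : {pred K}) s :
  integral_admissible sr L s -> candidate sr s (V 0 0 1).
Proof.
case=> _ bas pos sorts; rewrite /candidate /=; apply/positive_stateP.
have neq : tnth s 0 != tnth s 1.
  have := free_uniq (basis_free bas); rewrite !(tnth_nth 0).
  case: s {bas pos sorts} => -[|a [|b [|c []]]] //= _.
  by rewrite !inE negb_or => /andP[/andP[]].
have lex : sr (tnth s 1) <= sr (tnth s 0).
  move: sorts; rewrite !(tnth_nth 0).
  by case: s {bas pos neq} => -[|a [|b [|c []]]] //= _ /andP[].
have lt01 : 0 < sr (tnth s 0 - tnth s 1).
  rewrite rmorphB subr_gt0 lt_neqAle lex andbT.
  by rewrite (inj_eq (fmorph_inj sr)) eq_sym.
move: pos => /positive_stateP pos i; rewrite -/(apply_move (V 0 0 1) s).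
rewrite apply_head_difference mxE; have := pos 1; have := pos 2; rewrite !mxE.
by elim/forall_ord3: i; rewrite !(tuple3E [tuple _; _; _]).
Qed.

Lemma selected_module_bound (L : {pred K}) (le : rel move) s mv :
  integral_admissible sr L s -> selected sr sc le s mv ->
  conformal_module sr sc (next_state sr mv s)
    <= golden R ^+ 2 * conformal_module sr sc s.
Proof.
move=> adm [_ minmv]; have cand := head_difference_candidate adm.
have -> : conformal_module sr sc (next_state sr mv s)
          = conformal_module sr sc (apply_move mv s).
  by apply: conformal_module_perm; rewrite perm_sort.
apply: le_trans (minmv _ cand).1 _.
case: adm => _ _ pos _; case/andP: cand => _.
exact: conformal_module_head_difference.
Qed.

End Selection.

(** * Cubic fields with a nonreal embedding *)

Section CubicField.

Variables (R : realType) (K : fieldExtType rat).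
Variables (sr : {rmorphism K -> R}) (sc : {rmorphism K -> R[i]}).

Lemma rmorph_scale_rat (S : unitRingType) (f : {rmorphism K -> S}) (q : rat) u :
  f (q *: u) = ratr q * f u.
Proof. by rewrite -mulr_algl rmorphM alg_num_field fmorph_rat. Qed.

Lemma ratr_complex (q : rat) : ratr q = (ratr q : R)%:C.
Proof. by rewrite fmorph_rat. Qed.

(** The degree of [theta] divides 3 and is not 1, so it is 3, whereas the
    relation is given by a polynomial of degree at most 2. *)
Lemma cubic_relation_trivial (theta : K) (a b c : rat) :
  \dim {:K} = 3%N -> theta \notin 1%VS ->
  a%:A + b *: theta + c *: theta ^+ 2 = 0 -> [/\ a = 0, b = 0 & c = 0].
Proof.
move=> dimK thetaN rel; pose p := Poly [:: a; b; c].
have deg3 : (3 <= adjoin_degree 1%AS theta)%N.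
  have dvd3 : (adjoin_degree 1%AS theta %| 3)%N.
    have := dim_Fadjoin 1%AS theta; rewrite dimv1 muln1 => <-.
    by rewrite -dimK; apply: field_dimS; apply: subvf.
  have := adjoin_deg_eq1 1%AS theta; rewrite (negPf thetaN).
  by case: adjoin_degree dvd3 => [|[|[|]]].
have pE i : p`_i = [:: a; b; c]`_i by rewrite coef_Poly.
suff p0 : p = 0 by split; [have := pE 0%N|have := pE 1%N|have := pE 2%N];
                  rewrite p0 coef0.
have szp : (size p <= 3)%N by apply: size_Poly.
apply: (map_poly_inj (in_alg K)); rewrite rmorph0; apply/eqP.
rewrite -(root_small_adjoin_poly (K := 1%AS) (x := theta)) ?alg_polyOver //.
  have szm : (size (map_poly (in_alg K) p) <= 3)%N by rewrite size_map_poly.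
  rewrite rootE (horner_coef_wide _ szm) sum3E !coef_map !pE /=.
  by rewrite expr0 mulr1 expr1 !mulr_algl rel.
by rewrite size_map_poly (leq_trans szp).
Qed.

(** The complex embedding is determined by its values on a basis, so it is not
    real on some element of an integral basis of [L]; the sign is adjusted by
    passing to the opposite. *)
Lemma order_generator (L : {pred K}) :
  is_order L -> nonreal_embedding sc ->
  exists theta, [/\ theta \in L, complex.Im (sc theta) != 0 & 0 < sr theta].
Proof.
move=> [subL _ [e basE eL]] [u nonreal].
have Le i : tnth e i \in L.
  apply/eL; exists (fun j => (j == i)%:Z).
  rewrite (bigD1 i) //= eqxx mulr1z big1 ?addr0 // => j /negPf->.
  exact: mulr0z.
have [i imi] : exists i, complex.Im (sc (tnth e i)) != 0.
  apply: contrapT => none; case/negP: nonreal; apply/eqP.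
  rewrite (coord_basis basE (memvf u)) rmorph_sum Im_sum big1 // => i _.
  rewrite rmorph_scale_rat ratr_complex -tnth_nth.
  have : complex.Im (sc (tnth e i)) = 0.
    by apply/eqP; apply: contra_notT none => imi; exists i.
  by case: (sc _) => x y /= ->; rewrite mulr0 mul0r addr0.
have [pos|neg|/eqP z0] := ltgtP 0 (sr (tnth e i)).
- by exists (tnth e i).
- exists (- tnth e i); rewrite !rmorphN oppr_gt0; split=> //.
    have [one_mem sub_mem _] := subL.
    by rewrite -sub0r sub_mem // -(subrr 1) sub_mem.
  by case: (sc _) imi => x y /=; rewrite oppr_eq0.
- by move: z0 imi; rewrite eq_sym fmorph_eq0 => /eqP->; rewrite rmorph0 /= eqxx.
Qed.

Lemma nonreal_notin1 theta : complex.Im (sc theta) != 0 -> theta \notin 1%VS.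
Proof.
apply: contraNN => /vlineP[q ->].
by rewrite rmorph_scale_rat ratr_complex rmorph1 mulr1.
Qed.

(** If the deviations vanish, [sc] and [center * sr] agree on a basis, hence on
    the field; at 1 this gives [center = 1], and [sc] would be real. *)
Lemma dev_neq0 (s : 3.-tuple K) :
  basis_of {:K} s -> nonreal_embedding sc -> dev sr sc s != 0.
Proof.
move=> bas [u nonreal]; apply: contraNN nonreal => /eqP/rowP dev0.
have scE v : sc v = Defs.center sr sc s * (sr v)%:C.
  rewrite (coord_basis bas (memvf v)) !rmorph_sum mulr_sumr.
  apply: eq_bigr => i _; rewrite !rmorph_scale_rat rmorphM ratr_complex.
  have := dev0 i; rewrite !mxE -tnth_nth => /eqP; rewrite subr_eq0 => /eqP->.
  by rewrite mulrCA.
have := scE 1; rewrite !rmorph1 mulr1 => c1.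
by rewrite scE -c1 mul1r.
Qed.

(** Equality would make [u_1 / u_2] a root of [X^2 - X - 1], an irrational
    element of degree 2. *)
Lemma T_old_neq (L : {pred K}) (s : 3.-tuple K) :
  \dim {:K} = 3%N -> nonreal_embedding sc -> integral_admissible sr L s ->
  T_old sr sc s <> golden R ^+ 2 * T sr sc s.
Proof.
move=> dimK nonreal [_ bas pos _] /eqP; rewrite T_oldE /T.
have [_ ->] := head_form_leif (dev sr sc s) => /andP[/eqP w1 /eqP w2].
have := ray_head_ratio (@positive_stateP _ _ _ _ pos) (dev_neq0 bas nonreal)
  (dev_orthogonal sc pos) w1 w2.
rewrite !mxE -fmorphV -rmorphM; set u := _ / _ => uphi.
have free_s := basis_free bas.
have u1N0 : tnth s 1 != 0.
  by have := free_not0 free_s (mem_tnth 1 s); rewrite eq_sym.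
have quad : (-1)%:A + (-1) *: u + 1 *: u ^+ 2 = 0.
  apply: (fmorph_inj sr); rewrite !scaleN1r !scale1r rmorph0 !rmorphD !rmorphN.
  by rewrite rmorph1 rmorphXn uphi golden_sqr; ring.
have uN : u \notin 1%VS.
  apply/negP => /vlineP[q uq]; rewrite /u in uq.
  have {}uq : tnth s 0 = q *: tnth s 1.
    by apply: (mulIf (invr_neq0 u1N0)); rewrite uq -scalerAl divff.
  pose k (i : 'I_3) : rat := if i == 0 then 1 else if i == 1 then - q else 0.
  have k0 : \sum_(i < 3) k i *: s`_i = 0.
    by rewrite sum3E /= scale0r addr0 scale1r -!(tuple3E s) uq scaleNr subrr.
  by have /eqP := freeP free_s k k0 0; rewrite oner_eq0.
by have [] := cubic_relation_trivial dimK uN quad.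
Qed.

End CubicField.

(** * Energy ratios near the extremal ray *)

Section Approach.

Variables (R : realType) (K : fieldExtType rat).
Variables (sr : {rmorphism K -> R}) (sc : {rmorphism K -> R[i]}).
Implicit Types (s : 3.-tuple K).

Local Notation phi := (golden R).
Local Notation xi := (xi sr).
Local Notation dev := (dev sr sc).
Local Notation T := (T sr sc).
Local Notation T_old := (T_old sr sc).

Definition ray_error s : R := normc (dev s 0 1 / dev s 0 0 + phi%:C).
Definition tail_error s : R := normc (dev s 0 2 / dev s 0 0).

Lemma le_dist_normc (u v : R[i]) : normc u - normc v <= normc (u - v).
Proof. by rewrite lerBlDr -{1}(subrK v u) le_normcD. Qed.

Lemma le_normcB (u v : R[i]) : normc (u - v) <= normc u + normc v.
Proof. by rewrite -(normcN v) le_normcD. Qed.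

(** Orthogonality to [xi] gives
    [w_2 / w_1 = - x_1 / x_2 - (x_3 / x_2) (w_3 / w_1)], where [x_3 <= x_2]. *)
Lemma ray_error_le s : positive_state sr s -> xi s 0 2 <= xi s 0 1 ->
  dev s 0 0 != 0 -> ray_error s <= `|head_ratio sr s - phi| + tail_error s.
Proof.
move=> pos le21 w0; have := dev_orthogonal sc pos; rewrite sum3E => orth.
move/positive_stateP: pos => pos; have x1 := pos 1; have x2 := pos 2.
have x1C : (xi s 0 1)%:C != 0 by rewrite fmorph_eq0 gt_eqF.
have w1 : dev s 0 1 / dev s 0 0 = - (head_ratio sr s)%:C
          - (xi s 0 2 / xi s 0 1)%:C * (dev s 0 2 / dev s 0 0).
  apply: (mulfI x1C); apply: (mulIf w0); rewrite /head_ratio !fmorph_div.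
  apply/eqP; rewrite -subr_eq0; apply/eqP; rewrite -[RHS]orth.
  by field; rewrite w0 x1C.
rewrite /ray_error w1; set r := (xi s 0 2 / _)%:C; set v := dev s 0 2 / _.
have -> : - (head_ratio sr s)%:C - r * v + phi%:C
          = - ((head_ratio sr s - phi)%:C + r * v) by rewrite rmorphB; ring.
rewrite normcN.
apply: le_trans (le_normcD _ _) _; rewrite normc_real lerD2l.
rewrite normcM normc_real ger0_norm; last by rewrite divr_ge0 // ltW.
by rewrite ler_piMl ?normc_ge0 // ler_pdivrMr // mul1r.
Qed.

(** [head_deficitE] divided by [T >= |w_1|^2]. *)
Lemma energy_ratio_bounds s : dev s 0 0 != 0 ->
  phi ^+ 2 - phi * (ray_error s ^+ 2 + tail_error s ^+ 2)
    <= T_old s / T s <= phi ^+ 2.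
Proof.
move=> w0; have n0 : 0 < normc (dev s 0 0).
  by rewrite lt0r normc_eq0 w0 normc_ge0.
have T0 : normc (dev s 0 0) ^+ 2 <= T s.
  by rewrite /T energyE -addrA lerDl addr_ge0 ?sqr_ge0.
have Tgt0 : 0 < T s by apply: lt_le_trans T0; rewrite exprn_gt0.
have phi0 := golden_gt0 R; have /andP[phi1 _] := golden_bounds R.
rewrite T_oldE ler_pdivlMr // ler_pdivrMr //; apply/andP; split; last first.
  by case: (head_form_leif (dev s)).
have tailE : normc (dev s 0 2) = tail_error s * normc (dev s 0 0).
  by rewrite -normcM divfK.
have rayE : normc (dev s 0 1 + phi%:C * dev s 0 0)
            = ray_error s * normc (dev s 0 0).
  by rewrite -normcM mulrDl divfK.
have := head_deficitE (dev s); rewrite tailE rayE -/(T s).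
rewrite (exprMn _ (tail_error s)) (exprMn _ (ray_error s)).
have := sqr_ge0 (ray_error s); have := sqr_ge0 (tail_error s).
set n := _ ^+ 2 in T0 *; set d := _ ^+ 2; set e := _ ^+ 2; move=> e0 d0 deficit.
have ded : d * n <= d * T s by rewrite ler_wpM2l.
have ede : e * n <= e * T s by rewrite ler_wpM2l.
have dn0 : 0 <= d * n by rewrite mulr_ge0 ?sqr_ge0.
nra.
Qed.

Lemma fibonacci_limits (s : nat -> 3.-tuple K) :
  (forall n, positive_state sr (s n)) ->
  (forall n, xi (s n) 0 2 <= xi (s n) 0 1) ->
  (forall n, dev (s n) 0 0 != 0) ->
  ((fun n => head_ratio sr (s n)) @ \oo --> phi)%classic ->
  ((fun n => tail_error (s n)) @ \oo --> (0 : R))%classic ->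
  ((fun n => ray_error (s n)) @ \oo --> (0 : R))%classic /\
  ((fun n => T_old (s n) / T (s n)) @ \oo --> phi ^+ 2)%classic.
Proof.
move=> pos le21 w0 ratio tail.
have ray : ((fun n => ray_error (s n)) @ \oo --> (0 : R))%classic.
  apply: (squeeze_cvgr (f := fun=> 0)
           (h := fun n => `|head_ratio sr (s n) - phi| + tail_error (s n))).
  - by apply: nearW => n; rewrite normc_ge0 ray_error_le.
  - exact: cvg_cst.
  - rewrite -[X in (_ --> X)%classic]addr0; apply: cvgD tail.
    rewrite -(normr0 R); apply: cvg_norm; rewrite -(subrr phi).
    exact: (cvgB ratio (cvg_cst _)).
split=> //.
apply: (squeeze_cvgr (h := fun=> phi ^+ 2)
  (f := fun n => phi ^+ 2
                 - phi * (ray_error (s n) ^+ 2 + tail_error (s n) ^+ 2))).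
- by apply: nearW => n; apply: energy_ratio_bounds.
- have lim0 : phi ^+ 2 - phi * (0 * 0 + 0 * 0) = phi ^+ 2.
    by rewrite mulr0 addr0 mulr0 subr0.
  rewrite -[X in (_ --> X)%classic]lim0.
  apply: cvgB; first exact: cvg_cst.
  apply: cvgM; first exact: cvg_cst.
  by apply: cvgD; apply: cvgM.
- exact: cvg_cst.
Qed.

End Approach.

(** * States of Fibonacci type *)

Section FibonacciStates.

Variables (R : realType) (K : fieldExtType rat).
Variables (sr : {rmorphism K -> R}) (sc : {rmorphism K -> R[i]}).
Variable theta : K.

Local Notation phi := (golden R).
Local Notation xi := (xi sr).
Local Notation dev := (dev sr sc).
Local Notation t := (sr theta).
Local Notation z := (sc theta).

(** The quotient [a / b] prescribes the head ratio; the summand [theta *+ k]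
    produces a deviation along the extremal ray. *)
Definition fib_state (a b k : nat) : 3.-tuple K :=
  [tuple a%:R + theta *+ k; b%:R; theta ^+ 2].

Lemma xi_fib_state a b k :
  [/\ xi (fib_state a b k) 0 0 = a%:R + k%:R * t,
      xi (fib_state a b k) 0 1 = b%:R &
      xi (fib_state a b k) 0 2 = t ^+ 2].
Proof.
rewrite !mxE !(tuple3E (fib_state a b k)) /=; split; last exact: rmorphXn.
  by rewrite rmorphD rmorph_nat rmorphMn mulr_natl.
exact: rmorph_nat.
Qed.

Lemma nu_fib_state a b k :
  [/\ nu sc (fib_state a b k) 0 0 = a%:R + k%:R * z,
      nu sc (fib_state a b k) 0 1 = b%:R &
      nu sc (fib_state a b k) 0 2 = z ^+ 2].
Proof.
rewrite !mxE !(tuple3E (fib_state a b k)) /=; split; last exact: rmorphXn.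
  by rewrite rmorphD rmorph_nat rmorphMn mulr_natl.
exact: rmorph_nat.
Qed.

(** The deviations of [s] are those of [nu - xi], which is
    [(k (z - t), 0, z^2 - t^2)]; both entries are multiples of [z - t]. *)
Lemma dev_fib_state a b k (s := fib_state a b k) : positive_state sr s ->
  dev s 0 0 * (\sum_i xi s 0 i ^+ 2)%:C =
    (z - t%:C) * (k%:R * (xi s 0 1 ^+ 2 + xi s 0 2 ^+ 2)%:C
                  - (xi s 0 0 * xi s 0 2)%:C * (z + t%:C)) /\
  dev s 0 2 * (\sum_i xi s 0 i ^+ 2)%:C =
    (z - t%:C) * ((xi s 0 0 ^+ 2 + xi s 0 1 ^+ 2)%:C * (z + t%:C)
                  - (xi s 0 0 * xi s 0 2 * k%:R)%:C).
Proof.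
move=> /sum_xi_gt0/lt0r_neq0 N0.
have {}N0 : (\sum_i xi s 0 i ^+ 2)%:C != 0 by rewrite fmorph_eq0.
have devE i : dev s 0 i * (\sum_j xi s 0 j ^+ 2)%:C
   = nu sc s 0 i * (\sum_j xi s 0 j ^+ 2)%:C
     - (\sum_j (xi s 0 j)%:C * nu sc s 0 j) * (xi s 0 i)%:C.
  have -> : dev s 0 i = nu sc s 0 i - Defs.center sr sc s * (xi s 0 i)%:C.
    by rewrite mxE.
  rewrite mulrBl /Defs.center; congr (_ - _).
  by rewrite mulrAC divfK.
rewrite !devE !sum3E; case: (xi_fib_state a b k) (nu_fib_state a b k).
rewrite -/s => -> -> -> [-> -> ->].
rewrite !(rmorphD, rmorphM, rmorphXn, rmorph_nat).
split; ring.
Qed.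

(** Up to a common factor, [w_1] is [k (x_2^2 + x_3^2)] with an error of at most
    [3 c x_2^2], because [x_1 x_3 <= 3 x_2^2], whereas [w_3] is bounded by a
    multiple of [x_2^2] independent of [k]: the coefficient 10 comes from
    [x_1^2 + x_2^2 <= 10 x_2^2], and the 3 from [x_1 x_3 k <= 3 x_2^2]. *)
Lemma tail_error_fib_state a b k (s := fib_state a b k) (c : R) :
  positive_state sr s -> z != t%:C ->
  xi s 0 0 <= 3 * xi s 0 1 -> xi s 0 2 <= xi s 0 1 ->
  xi s 0 2 * k%:R <= xi s 0 1 ->
  normc (z + t%:C) <= c -> 0 < k%:R - 3 * c ->
  dev s 0 0 != 0 /\ tail_error sr sc s <= (10 * c + 3) / (k%:R - 3 * c).
Proof.
move=> pos zt; have [dev0 dev2] := dev_fib_state pos; rewrite -/s in dev0 dev2.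
have N0 := sum_xi_gt0 pos; have k0 := ler0n R k.
have nc := normc_ge0 (z + t%:C).
move: pos => /positive_stateP pos; have := pos 0; have := pos 1; have := pos 2.
move: dev0 dev2 N0; move: (xi s 0 0) (xi s 0 1) (xi s 0 2) (\sum_i _).
move=> x0 x1 x2 N dev0 dev2 N0 x2pos x1pos x0pos le01 le21 le2k cz kc.
set P := k%:R * _ - _ in dev0; set Q := _ * (z + _) - _ in dev2.
have x1sq : 0 < x1 ^+ 2 by rewrite exprn_gt0.
have Pge : (k%:R - 3 * c) * x1 ^+ 2 <= normc P.
  rewrite /P; apply: le_trans (le_dist_normc _ _).
  rewrite -(rmorph_nat (real_complex R)) -rmorphM normcM !normc_real.
  rewrite !ger0_norm ?mulr_ge0 ?addr_ge0 ?sqr_ge0 //; try exact: ltW.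
  have : x0 * x2 * normc (z + t%:C) <= 3 * x1 ^+ 2 * c.
    by apply: ler_pM => //; nra.
  by have := sqr_ge0 x2; nra.
have Qle : normc Q <= (10 * c + 3) * x1 ^+ 2.
  rewrite /Q; apply: le_trans (le_normcB _ _) _; rewrite normcM !normc_real.
  rewrite !ger0_norm ?addr_ge0 ?sqr_ge0 //; last by rewrite !mulr_ge0 // ltW.
  have : (x0 ^+ 2 + x1 ^+ 2) * normc (z + t%:C) <= 10 * x1 ^+ 2 * c.
    by apply: ler_pM => //; nra.
  have : x0 * (x2 * k%:R) <= 3 * x1 * x1 by apply: ler_pM => //; nra.
  lra.
have Ppos : 0 < normc P by apply: lt_le_trans Pge; rewrite mulr_gt0.
have P0 : P != 0 by rewrite -normc_eq0 gt_eqF.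
have NC : N%:C != 0 by rewrite fmorph_eq0 gt_eqF.
have ztB : z - t%:C != 0 by rewrite subr_eq0.
have w0 : dev s 0 0 != 0.
  apply/negP => /eqP w0; move/eqP: dev0; rewrite w0 mul0r eq_sym mulf_eq0.
  by rewrite (negPf ztB) (negPf P0).
split=> //; rewrite /tail_error.
have -> : dev s 0 2 / dev s 0 0 = Q / P.
  apply: (mulIf w0); rewrite divfK //; apply: (mulIf P0).
  apply: (mulIf NC); apply: (mulfI ztB).
  transitivity (dev s 0 2 * N%:C * ((z - t%:C) * P)); first by ring.
  rewrite dev2 -dev0; field; exact: P0.
rewrite normcM normcV ler_pdivrMr // mulrAC ler_pdivlMr //.
have c0 : 0 <= c by lra.
apply: le_trans (_ : (10 * c + 3) * x1 ^+ 2 * (k%:R - 3 * c) <= _).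
  by apply: ler_wpM2r => //; apply: ltW.
by rewrite -mulrA ler_wpM2l //; lra.
Qed.

Lemma fib_state_basis a b k : \dim {:K} = 3%N -> theta \notin 1%VS ->
  (0 < b)%N -> (0 < k)%N -> basis_of {:K} (fib_state a b k).
Proof.
move=> dimK thetaN b0 k0; rewrite basisEfree subvf size_tuple dimK leqnn !andbT.
apply/freeP => c; rewrite sum3E -!(tuple3E (fib_state a b k)) => rel.
have {}rel : (c 0 * a%:R + c 1 * b%:R)%:A + (c 0 * k%:R) *: theta
             + c 2 *: theta ^+ 2 = 0.
  rewrite -[RHS]rel !(tuple3E (fib_state a b k)) /=.
  rewrite scalerDl scalerDr -!scalerA !scaler_nat; congr (_ + _).
  exact: addrAC.
have [c01 c0 c2] := cubic_relation_trivial dimK thetaN rel.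
have natN0 n : (0 < n)%N -> n%:R != 0 :> rat by rewrite pnatr_eq0 lt0n.
have {}c0 : c 0 = 0.
  by move/eqP: c0; rewrite mulf_eq0 (negPf (natN0 _ k0)) orbF => /eqP.
have {}c1 : c 1 = 0.
  move/eqP: c01; rewrite c0 mul0r add0r mulf_eq0 (negPf (natN0 _ b0)) orbF.
  by move/eqP.
by elim/forall_ord3.
Qed.

Lemma fib_state_mem (L : {pred K}) a b k : GRing.subring_closed L ->
  theta \in L -> all [in L] (fib_state a b k).
Proof.
move=> [L1 LB LM] Ltheta.
have L0 : 0 \in L by rewrite -(subrr 1) LB.
have LD u v : u \in L -> v \in L -> u + v \in L.
  by move=> Lu Lv; rewrite -[v]opprK LB // -sub0r LB.
have LMn u n : u \in L -> u *+ n \in L.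
  by move=> Lu; elim: n => [|n IH]; rewrite ?mulr0n // mulrS LD.
by rewrite /= LD ?LMn // expr2 LM.
Qed.

End FibonacciStates.

(** First [k] is chosen to tend to infinity, then [M] so large with respect to
    [k] that the head ratio is prescribed up to [eps n]. *)
Lemma fibonacci_states_exist (R : realType) (K : fieldExtType rat)
    (sr : {rmorphism K -> R}) (sc : {rmorphism K -> R[i]}) (L : {pred K})
    (eps : nat -> R) :
  \dim {:K} = 3%N -> nonreal_embedding sc -> is_order L ->
  (forall n, 0 < eps n) ->
  exists s : nat -> 3.-tuple K,
    [/\ forall n, integral_admissible sr L (s n),
        fibonacci_type sr sc eps s &
        ((fun n => T_old sr sc (s n) / T sr sc (s n))
           @ \oo --> golden R ^+ 2)%classic].
Proof.
move=> dimK nonreal ordL eps0.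
have [theta [Ltheta im_theta t0]] := order_generator sr ordL nonreal.
set t := sr theta in t0; set z := sc theta in im_theta.
have zt : z != t%:C by apply: contraNneq im_theta => ->.
pose c := normc (z + t%:C); have c0 : 0 <= c := normc_ge0 _.
(* [k] makes the denominator [k - 3 c] of the tail bound at least [n + 1]. *)
pose k n : nat := (n.+1 + (Num.trunc (3 * c)).+1)%N.
have k_gt0 n : (0 < k n)%N by [].
have kgt n : n.+1%:R <= (k n)%:R - 3 * c.
  by rewrite lerBrDr natrD lerD2l ltW // truncnS_gt.
(* The summands of [B] make [x_3 k] and [k t] at most [x_2], and the head ratio
   closer than [eps n] and [1 / (n + 1)] to its Fibonacci quotient. *)
pose B n : R := (k n)%:R * t ^+ 2 + (k n)%:R * t + (k n)%:R * t / eps n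
                + (k n)%:R * t * n.+1%:R.
pose M n : nat := (Num.trunc (B n)).+1.
pose s n := fib_state theta (fib n.+2 * M n) (fib n.+1 * M n) (k n).
have kt_gt0 n : 0 < (k n)%:R * t by rewrite mulr_gt0 // ltr0n.
have kt2_gt0 n : 0 < (k n)%:R * t ^+ 2 by rewrite mulr_gt0 ?exprn_gt0 // ltr0n.
have MB n : B n < (M n)%:R by apply: truncnS_gt.
have Bparts n : [/\ (k n)%:R * t ^+ 2 < (M n)%:R, (k n)%:R * t < (M n)%:R,
      (k n)%:R * t / eps n < (M n)%:R & (k n)%:R * t * n.+1%:R < (M n)%:R].
  have := MB n; have := kt_gt0 n; have := kt2_gt0 n.
  have : 0 < (k n)%:R * t / eps n by rewrite divr_gt0.
  have : 0 < (k n)%:R * t * n.+1%:R by rewrite mulr_gt0.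
  by rewrite /B => *; split; lra.
have M0 n : 0 < (M n)%:R :> R by rewrite ltr0n.
have F1 n : 1 <= (fib n.+1)%:R :> R by rewrite ler1n fib_gt0.
have F2 n : (fib n.+1)%:R <= (fib n.+2)%:R :> R by rewrite ler_nat fib_mono.
have F3 n : (fib n.+2)%:R <= 2 * (fib n.+1)%:R :> R.
  by rewrite -natrM ler_nat fib_le.
have xiE n : [/\ xi sr (s n) 0 0 = (fib n.+2)%:R * (M n)%:R + (k n)%:R * t,
                 xi sr (s n) 0 1 = (fib n.+1)%:R * (M n)%:R &
                 xi sr (s n) 0 2 = t ^+ 2].
  have := xi_fib_state sr theta (fib n.+2 * M n) (fib n.+1 * M n) (k n).
  by case=> -> -> ->; rewrite !natrM.
have M1 n : (M n)%:R <= xi sr (s n) 0 1.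
  by case: (xiE n) => _ -> _; rewrite ler_peMl // ltW.
have k1 n : 1 <= (k n)%:R :> R by rewrite ler1n.
have le2k n : xi sr (s n) 0 2 * (k n)%:R <= xi sr (s n) 0 1.
  by apply: le_trans (M1 n); case: (xiE n) (Bparts n) => _ _ -> [? _ _ _]; lra.
have le21 n : xi sr (s n) 0 2 <= xi sr (s n) 0 1.
  apply: le_trans (le2k n); rewrite ler_peMr //.
  by case: (xiE n) => _ _ ->; apply: sqr_ge0.
have le10 n : xi sr (s n) 0 1 <= xi sr (s n) 0 0.
  case: (xiE n) => -> -> _; have := kt_gt0 n; have := F2 n.
  by rewrite -(ler_pM2r (M0 n)); lra.
have le03 n : xi sr (s n) 0 0 <= 3 * xi sr (s n) 0 1.
  have := M1 n; case: (xiE n) (Bparts n) => -> -> _ [_ ? _ _].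
  by have := F3 n; rewrite -(ler_pM2r (M0 n)); lra.
have pos n : positive_state sr (s n).
  have x2 : 0 < xi sr (s n) 0 2 by case: (xiE n) => _ _ ->; rewrite exprn_gt0.
  have x1 := lt_le_trans x2 (le21 n); have x0 := lt_le_trans x1 (le10 n).
  by apply/positive_stateP; elim/forall_ord3.
have ratioE n : head_ratio sr (s n) - (fib n.+2)%:R / (fib n.+1)%:R
                = (k n)%:R * t / ((fib n.+1)%:R * (M n)%:R).
  rewrite /head_ratio; case: (xiE n) => -> -> _.
  by field; rewrite gt_eqF ?M0 // gt_eqF // (lt_le_trans ltr01).
have ratio_lt n (e : R) : 0 < e -> (k n)%:R * t / e < (M n)%:R ->
    `|head_ratio sr (s n) - (fib n.+2)%:R / (fib n.+1)%:R| < e.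
  move=> e0; rewrite ltr_pdivrMr // => lt_e.
  rewrite ratioE ger0_norm; last first.
    by apply: divr_ge0; [exact/ltW/kt_gt0 | rewrite -natrM ler0n].
  have FM0 : 0 < (fib n.+1)%:R * (M n)%:R :> R.
    by rewrite mulr_gt0 // (lt_le_trans ltr01).
  rewrite ltr_pdivrMr // (lt_le_trans lt_e) // mulrC ler_wpM2l ?(ltW e0) //.
  by rewrite ler_peMl // ltW.
have [w0 tail] : (forall n, dev sr sc (s n) 0 0 != 0) /\
     (forall n, tail_error sr sc (s n) <= (10 * c + 3) * harmonic n).
  suff H n : dev sr sc (s n) 0 0 != 0 /\
             tail_error sr sc (s n) <= (10 * c + 3) * harmonic n.
    by split=> n; case: (H n).
  have kc0 : 0 < (k n)%:R - 3 * c by apply: lt_le_trans (kgt n).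
  have [-> le_tail] := tail_error_fib_state (pos n) zt (le03 n) (le21 n)
                         (le2k n) (lexx c) kc0.
  split=> //; apply: le_trans le_tail _; rewrite ler_wpM2l //; first by lra.
  by rewrite /harmonic lef_pV2 ?posrE.
have phi0 : 0 <= golden R - 1 by have := golden_bounds R; lra.
have phi_lt1 : `|golden R - 1| < 1.
  by rewrite ger0_norm //; have := golden_bounds R; lra.
have ratio_lim : ((fun n => head_ratio sr (s n)) @ \oo --> golden R)%classic.
  pose e n : R := harmonic n + (golden R - 1) ^+ n.
  have e_lim : (e @ \oo --> (0 : R))%classic.
    rewrite -[X in (_ --> X)%classic](addr0 0).
    by apply: cvgD; [exact: cvg_harmonic | exact: cvg_expr].
  have bound n : golden R - e n <= head_ratio sr (s n) <= golden R + e n.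
    rewrite -ler_distl; apply: le_trans (ler_distD _ _ _) _.
    apply: lerD (fib_ratio_golden R n); apply/ltW/ratio_lt.
      by rewrite /harmonic invr_gt0.
    by rewrite /harmonic invrK; case: (Bparts n).
  apply: (squeeze_cvgr (f := fun n => golden R - e n)
                       (h := fun n => golden R + e n)).
  - exact: nearW.
  - rewrite -[X in (_ --> X)%classic]subr0.
    by apply: cvgB e_lim; apply: cvg_cst.
  - rewrite -[X in (_ --> X)%classic]addr0.
    by apply: cvgD e_lim; apply: cvg_cst.
have tail_lim : ((fun n => tail_error sr sc (s n)) @ \oo --> (0 : R))%classic.
  apply: (squeeze_cvgr (f := fun=> 0)
                       (h := fun n => (10 * c + 3) * harmonic n)).
  - by apply: nearW => n; rewrite normc_ge0 tail.
  - exact: cvg_cst.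
  - rewrite -[X in (_ --> X)%classic](mulr0 (10 * c + 3)).
    by apply: cvgM; [exact: cvg_cst | exact: cvg_harmonic].
have [ray_lim energy_lim] := fibonacci_limits pos le21 w0 ratio_lim tail_lim.
exists s; split=> //.
  move=> n; split.
  - by case: ordL => subL _ _; apply: fib_state_mem.
  - apply: fib_state_basis => //; first exact: nonreal_notin1 im_theta.
    by rewrite muln_gt0 fib_gt0.
  - exact: pos.
  - have := le10 n; have := le21 n; rewrite !mxE /= /decreasing.
    by rewrite !(tuple3E (s n)) /= => -> ->.
split=> // n; apply: ratio_lt => //.
by case: (Bparts n).
Qed.

(** * The constant of the selected move *)

Theorem lemma4p4 (R : realType) (K : fieldExtType rat)
    (sr : {rmorphism K -> R}) (sc : {rmorphism K -> R[i]})
    (L : {pred K}) (le : rel move)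
    (dimK : \dim {:K} = 3%N) (sigK : signature11 sr sc)
    (ordL : is_order L) (totle : total_order le) :
  let phi := golden R in
  [/\ phi ^+ 2 = (3 + Num.sqrt 5) / 2,
      (* the selected move exists, is unique, and satisfies the bound *)
      forall s : 3.-tuple K, integral_admissible sr L s ->
        (exists! mv : move, selected sr sc le s mv) /\
        (forall mv : move, selected sr sc le s mv ->
           conformal_module sr sc (next_state sr mv s)
             <= phi ^+ 2 * conformal_module sr sc s),
      (* the old-center energy estimate, not attained on integral states *)
      forall s : 3.-tuple K, integral_admissible sr L s ->
        T_old sr sc s <= phi ^+ 2 * T sr sc s /\
        T_old sr sc s <> phi ^+ 2 * T sr sc s,
      (* equality case of the quadratic form, and its head ratio *)
      (forall w : 'rV[R[i]]_3,
         head_form w <= phi ^+ 2 * energy w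
           ?= iff ((w 0 1 == - phi%:C * w 0 0) && (w 0 2 == 0))) /\
      (forall (x : 'rV[R]_3) (w : 'rV[R[i]]_3),
         (forall i, 0 < x 0 i) -> w != 0 ->
         \sum_i (x 0 i)%:C * w 0 i = 0 ->
         w 0 1 = - phi%:C * w 0 0 -> w 0 2 = 0 ->
         x 0 0 / x 0 1 = phi) &
      (* the constant is approached by Fibonacci-type profiles *)
      forall eps : nat -> R, (forall n, 0 < eps n) ->
        exists s : nat -> 3.-tuple K,
          [/\ forall n, integral_admissible sr L (s n),
              fibonacci_type sr sc eps s &
              ((fun n => T_old sr sc (s n) / T sr sc (s n))
                 @ \oo --> phi ^+ 2)%classic]].
Proof.
move=> phi; have nonreal : nonreal_embedding sc by case: sigK.
split.
- exact: golden_sqrE.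
- move=> s adm; split; last by move=> mv; apply: selected_module_bound adm.
  have cand := head_difference_candidate adm; case: adm => _ _ pos _.
  exact: selected_exists_unique cand.
- move=> s adm; split; last exact: T_old_neq adm.
  by rewrite T_oldE; case: (head_form_leif (dev sr sc s)).
- by split=> [w|x w]; [apply: head_form_leif | apply: ray_head_ratio].
- by move=> eps eps0; apply: fibonacci_states_exist ordL eps0.
Qed.
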